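(* Let $G(x,t)=\sum_{n=0}^\infty c_n g_n(x)t^n$ be a two-variable generating function (the coefficients $c_n$ being independent of $x$ and $t$). Let $\delta,\omega\ge 0$ be real with $\delta+\omega>0$, and suppose that $x$ and $t$ are such that the series $G(x,tu^\delta(1-u)^\omega)=\sum_{n=0}^\infty c_n g_n(x)\,t^n u^{\delta n}(1-u)^{\omega n}$ converges uniformly for $u\in(0,1)$. Let $s>r>0$, $\lambda\ge0$ and $p\in\mathbb{C}$; when $\lambda=0$ assume also $|p|<4$. Then $$\int_0^1 u^{r-1}(1-u)^{s-r-1}\,G\bigl(x,tu^\delta(1-u)^\omega\bigr)\,E_\lambda[p\,u(1-u)]\,du$$ $$=\sum_{n=0}^\infty c_n g_n(x)\,t^n\;{}_3\Psi_2\left[\begin{array}{c}(r+\delta n,1),(s-r+\omega n,1),(1,1);\\(s+\delta n+\omega n,2),(1,\lambda);\end{array}\;p\right].$$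
   Context: The Mittag-Leffler function is $E_\lambda(z)=\sum_{n=0}^\infty \frac{z^n}{\Gamma(\lambda n+1)}$ for $\lambda\ge 0$; for $\lambda=0$ it is $E_0(z)=1/(1-z)$ with $|z|<1$. The (un-normalized) Wright hypergeometric function is $${}_p\Psi_q\left[\begin{array}{c}(a_1,A_1),\ldots,(a_p,A_p);\\(b_1,B_1),\ldots,(b_q,B_q);\end{array}z\right]=\sum_{k=0}^\infty\frac{\prod_{j=1}^p\Gamma(a_j+A_jk)}{\prod_{j=1}^q\Gamma(b_j+B_jk)}\,\frac{z^k}{k!}$$ (a parameter pair $(1,0)$ contributes the factor $1$). *)

(* Defs.v *)
From HB Require Import structures.
From mathcomp Require Import all_boot all_order all_algebra.
From mathcomp Require Import complex.
From mathcomp Require Import all_classical all_reals all_analysis.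

Set Implicit Arguments.
Unset Strict Implicit.
Unset Printing Implicit Defensive.

Import Order.TTheory GRing.Theory Num.Theory.
Import numFieldNormedType.Exports.

Local Open Scope classical_set_scope.
Local Open Scope ring_scope.
Local Open Scope complex_scope.

(* The topology of [R[i]] is the one of its modulus, which the libraries attach
   to the alias [R[i]^o].  [csum u] is meaningful only when [csummable u]. *)
Definition csummable (R : realType) (u : nat -> R[i]) : Prop :=
  cvgn (series u : nat -> R[i]^o).

Definition csum (R : realType) (u : nat -> R[i]) : R[i] :=
  limn (series u : nat -> R[i]^o).

Definition cintegrable (R : realType) (D : set R) (f : R -> R[i]) : Prop :=
  (@lebesgue_measure R).-integrable D (EFin \o (fun u => complex.Re (f u))) /\
  (@lebesgue_measure R).-integrable D (EFin \o (fun u => complex.Im (f u))).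

Definition cintegral (R : realType) (D : set R) (f : R -> R[i]) : R[i] :=
  (\int[@lebesgue_measure R]_(u in D) complex.Re (f u)) +i*
  (\int[@lebesgue_measure R]_(u in D) complex.Im (f u)).

(* Euler's integral, hence the Gamma function for [0 < a] only (the integral
   diverges otherwise). *)
Definition Gamma (R : realType) (a : R) : R :=
  \int[@lebesgue_measure R]_(y in `]0, +oo[) (y `^ (a - 1) * expR (- y)).

Definition mittag_leffler_term (R : realType) (l : R) (z : R[i]) (n : nat)
    : R[i] :=
  z ^+ n / (Gamma (l * n%:R + 1))%:C.

(* For [l = 0] this is the geometric series, i.e. [1 / (1 - z)] on the unit
   disc. *)
Definition mittag_leffler (R : realType) (l : R) (z : R[i]) : R[i] :=
  csum (mittag_leffler_term l z).

(* The un-normalized Wright function, for real parameters with all the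
   [a_j + A_j k] and [b_j + B_j k] positive; [p] and [q] are the lengths of
   the two lists of pairs. *)
Definition wright_term (R : realType) (a b : seq (R * R)) (z : R[i]) (k : nat)
    : R[i] :=
  ((\prod_(aj <- a) Gamma (aj.1 + aj.2 * k%:R)) /
   (\prod_(bj <- b) Gamma (bj.1 + bj.2 * k%:R)))%:C * (z ^+ k / (k`!)%:R).

Definition wright (R : realType) (a b : seq (R * R)) (z : R[i]) : R[i] :=
  csum (wright_term a b z).

Definition genfun_term (R : realType) (X : Type) (c : nat -> R[i])
    (g : nat -> X -> R[i]) (x : X) (z : R[i]) (n : nat) : R[i] :=
  c n * g n x * z ^+ n.

Definition genfun (R : realType) (X : Type) (c : nat -> R[i])
    (g : nat -> X -> R[i]) (x : X) (z : R[i]) : R[i] :=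
  csum (genfun_term c g x z).

(* Main.v *)
Require Import Defs.
From HB Require Import structures.
From mathcomp Require Import all_boot all_order all_algebra.
From mathcomp Require Import complex.
From mathcomp Require Import all_classical all_reals all_analysis.
From mathcomp Require Import measurable_realfun.
From mathcomp Require Import ring lra.

Set Implicit Arguments.
Unset Strict Implicit.
Unset Printing Implicit Defensive.

Import Order.TTheory GRing.Theory Num.Theory.
Import numFieldNormedType.Exports.

Local Open Scope classical_set_scope.
Local Open Scope ring_scope.
Local Open Scope complex_scope.

(** Substitute the series of [G] and of the Mittag-Leffler function into the
integral and integrate term by term.  Each elementary term is an Euler beta
integral,
  [int_0^1 u^(A-1) (1-u)^(B-1) du = Gamma A * Gamma B / Gamma (A + B)]
with [A = r + delta n + k] and [B = s - r + omega n + k]; summing over [k]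
gives the Wright function of index [n], and summing over [n] gives the
right-hand side.  What has to be proved is the beta integral and the two
exchanges of sum and integral.

The beta integral ([eGamma_eBeta], [eBeta_Gamma]) is proved with extended real
values, so that no integrability is needed beforehand: the product
[Gamma a * Gamma b] is the integral over the plane of
[x^(a-1) e^(-x) y^(b-1) e^(-y)], and Tonelli's theorem together with the affine
substitutions [y = z - x] and [x = z u] turns it into [Gamma (a + b) * B(a, b)].
Taking [b = 1] yields [Gamma (a + 1) = a * Gamma a], hence factorials at the
integers; comparison with these shows that [Gamma] is finite, which makes the
beta integrals finite as well.

The exchanges rest on dominated convergence ([cintegral_bounded_series]): a
series of functions whose partial sums are uniformly bounded may be integrated
term by term against an integrable weight.  On the unit interval
[0 <= u (1 - u) <= 1/4], so the Mittag-Leffler series is bounded term by term by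
[sum_k (|p|/4)^k / Gamma (lambda k + 1)].  This converges: for [lambda = 0] it
is geometric of ratio [|p|/4 < 1], and for [lambda > 0] the elementary estimate
[Gamma (lambda k + 1) >= M^(lambda k) e^(-(M+1))], valid for every [M > 0]
([Gamma_ge]), bounds it by a geometric series of ratio as small as desired.
The partial sums of [G] are uniformly bounded from some rank on, because they
converge uniformly and each of them is bounded. *)

(** * Affine change of variable *)

Section affine_change_of_variable.
Variable R : realType.
Local Notation mu := (@lebesgue_measure R).
Local Open Scope ereal_scope.

Let affine (k c : R) : measurableTypeR R -> measurableTypeR R :=
  fun x => (k * x + c)%R.

Let measurable_affine k c : measurable_fun setT (affine k c).
Proof. by apply: measurable_funD => //; apply: measurable_funM. Qed.

Let lebesgue_measure_affine (k : {nonneg R}) (c : R) (A : set R) :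
  (0 < k%:num)%R -> measurable A ->
  pushforward (mscale k mu) (affine k%:num c) A = mu A.
Proof.
move=> k0 mA; apply/esym/lebesgue_measure_unique => // _ [[a b]] _ <-.
rewrite /= /pushforward /mscale /=.
have -> : affine k%:num c @^-1` `]a, b] =
    `]((a - c) / k%:num)%R, ((b - c) / k%:num)%R]%classic.
  by apply/seteqP; split => x /=;
    rewrite !in_itv /= ltr_pdivrMr// ler_pdivlMr// ltrBlDr lerBrDr mulrC.
rewrite !lebesgue_measure_itv/= !lte_fin.
rewrite ltr_pM2r ?invr_gt0// ltrD2r; case: ifPn => _; last by rewrite mule0.
by rewrite -!EFinB -EFinM; congr EFin; field; rewrite gt_eqF.
Qed.

(** By uniqueness of the Lebesgue measure, [k] times its image under
[x |-> k x + c] is the Lebesgue measure itself.  No continuity of [f] is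
required, which matters for integrands that vanish outside an interval. *)
Lemma ge0_integral_affine (k c : R) (f : R -> \bar R) : (0 < k)%R ->
  measurable_fun setT f -> (forall x, 0 <= f x) ->
  k%:E * \int[mu]_x f (k * x + c)%R = \int[mu]_x f x.
Proof.
move=> k0 mf f0; pose K := NngNum (ltW k0).
transitivity (\int[pushforward (mscale K mu) (affine k c)]_x f x).
  rewrite ge0_integral_pushforward// preimage_setT ge0_integral_mscale//=.
  exact: measurableT_comp.
apply: eq_measure_integral => //= A mA _.
by rewrite -(@lebesgue_measure_affine K c A k0 mA).
Qed.
End affine_change_of_variable.

(** * Euler's beta integral *)

Section gamma_beta.
Variable R : realType.
Implicit Types a b x y z u : R.
Local Notation mu := (@lebesgue_measure R).

(** Both integrands are extended by zero to the whole line, so that affine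
substitutions never change the domain of integration. *)
Definition gamma_integrand a : R -> R :=
  (fun y => y `^ (a - 1) * expR (- y)) \_ `]0, +oo[.

Definition beta_integrand a b : R -> R :=
  (fun u => u `^ (a - 1) * (1 - u) `^ (b - 1)) \_ `]0, 1[.

Definition eGamma a : \bar R := (\int[mu]_y (gamma_integrand a y)%:E)%E.

Definition eBeta a b : \bar R := (\int[mu]_u (beta_integrand a b u)%:E)%E.

Lemma gamma_integrand_ge0 a y : 0 <= gamma_integrand a y.
Proof.
rewrite /gamma_integrand patchE; case: ifP => // _.
by rewrite mulr_ge0 ?powR_ge0 ?expR_ge0.
Qed.

Lemma beta_integrand_ge0 a b u : 0 <= beta_integrand a b u.
Proof.
by rewrite /beta_integrand patchE; case: ifP => // _; rewrite mulr_ge0 ?powR_ge0.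
Qed.

Lemma measurable_gamma_integrand a : measurable_fun setT (gamma_integrand a).
Proof.
apply/(measurable_restrictT _ _).1 => //; apply: measurable_funTS.
apply: measurable_funM => //.
by apply: measurableT_comp => //; exact: measurableT_comp.
Qed.

Lemma measurable_beta_integrand a b : measurable_fun setT (beta_integrand a b).
Proof.
apply/(measurable_restrictT _ _).1 => //; apply: measurable_funTS.
apply: measurable_funM => //.
by apply: (measurableT_comp (measurable_powR _)); exact: measurable_funB.
Qed.

Lemma eGamma_ge0 a : (0 <= eGamma a)%E.
Proof. by apply: integral_ge0 => y _; rewrite lee_fin gamma_integrand_ge0. Qed.

Lemma eBeta_ge0 a b : (0 <= eBeta a b)%E.
Proof. by apply: integral_ge0 => y _; rewrite lee_fin beta_integrand_ge0. Qed.

Lemma GammaE a : Gamma a = fine (eGamma a).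
Proof.
rewrite /Gamma /Rintegral /eGamma integral_mkcond; congr fine.
by apply: eq_integral => y _; rewrite restrict_EFin.
Qed.

Lemma eBetaE a b : eBeta a b =
  (\int[mu]_(u in `]0%R, 1%R[) (u `^ (a - 1) * (1 - u) `^ (b - 1))%:E)%E.
Proof.
rewrite /eBeta [RHS]integral_mkcond.
by apply: eq_integral => u _; rewrite restrict_EFin.
Qed.

(** After the substitutions [y = z - x] and [x = z u], the integrand of the
product of two Gamma integrals separates in [z] and [u].  The factor [z] on the
left is the Jacobian of [x = z u]. *)
Lemma gamma_integrand_convolution a b z u : 0 < z ->
  z * (gamma_integrand a (z * u) * gamma_integrand b (z - z * u)) =
  gamma_integrand (a + b) z * beta_integrand a b u.
Proof.
move=> z0; rewrite /gamma_integrand /beta_integrand !patchE !mem_setE !in_itv /= !andbT.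
have -> : z - z * u = z * (1 - u) by rewrite mulrBr mulr1.
rewrite z0 !pmulr_rgt0// subr_gt0.
case: ltP => u0 /=; last by rewrite mul0r !mulr0.
case: ltP => u1; last by rewrite !mulr0.
have u1' : 0 <= 1 - u by rewrite subr_ge0 ltW.
rewrite !powRM ?(ltW z0) ?(ltW u0)//.
have -> : expR (- z) = expR (- (z * u)) * expR (- (z * (1 - u))).
  by rewrite -expRD; congr expR; ring.
have -> : z `^ (a + b - 1) = z * z `^ (a - 1) * z `^ (b - 1).
  rewrite -{2}(powRr1 (ltW z0)) -!powRD ?(gt_eqF z0) ?implybT//.
  by congr powR; ring.
ring.
Qed.

(** Euler's identity in the extended reals, where Tonelli's theorem applies
without any integrability condition and hence for all real [a] and [b]. *)
Lemma eGamma_eBeta a b : (eGamma a * eGamma b = eGamma (a + b) * eBeta a b)%E.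
Proof.
have mg c := measurable_gamma_integrand c.
have mEg c : measurable_fun setT (fun x => (gamma_integrand c x)%:E).
  exact/measurable_EFinP.
have g0 c x : (0 <= (gamma_integrand c x)%:E)%E.
  by rewrite lee_fin gamma_integrand_ge0.
pose F (x : R * R) :=
  (gamma_integrand a x.1 * gamma_integrand b (x.2 - x.1))%:E.
have F0 (w : R * R) : (0 <= F w)%E.
  by rewrite lee_fin mulr_ge0 ?gamma_integrand_ge0.
have mF : measurable_fun setT F.
  apply/measurable_EFinP; apply: measurable_funM.
    exact: (measurableT_comp (mg a) measurable_fst).
  apply: (measurableT_comp (mg b)).
  by apply: measurable_funB; [exact: measurable_snd|exact: measurable_fst].
transitivity (\int[mu]_x \int[mu]_z F (x, z))%E.
  rewrite {1}/eGamma -ge0_integralZr//=; first last.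
  - exact: eGamma_ge0.
  - exact: mEg.
  apply: eq_integral => x _.
  rewrite /eGamma -(@ge0_integral_affine _ 1 (- x)) //.
  have mshift : measurable_fun setT
      (fun z => (gamma_integrand b (1 * z + - x))%:E).
    apply: (measurableT_comp (mEg b)).
    by apply: measurable_funD => //; exact: measurable_funM.
  have gshift z : [set: R] z -> (0 <= (gamma_integrand b (1 * z + - x))%:E)%E.
    by move=> _; exact: g0.
  rewrite mul1e -(ge0_integralZl mu measurableT mshift gshift (g0 a x)).
  by apply: eq_integral => z _; rewrite /F /= mul1r EFinM.
transitivity (\int[mu]_z \int[mu]_x F (x, z))%E.
  exact: (@fubini_tonelli _ _ _ _ _ mu mu F).
rewrite [in RHS]/eGamma -ge0_integralZr//=; first last.
- exact: eBeta_ge0.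
- exact: mEg.
apply: eq_integral => z _.
have [z0|z0] := ltP 0 z; last first.
  (* [0 < x] and [0 < z - x] are incompatible with [z <= 0] *)
  rewrite [in RHS]/gamma_integrand patchE mem_setE in_itv/= andbT ltNge z0 mul0e.
  apply: integral0_eq => x _.
  rewrite /F /= /gamma_integrand !patchE !mem_setE !in_itv /= !andbT.
  case: ltP => x0; last by rewrite mul0r.
  by rewrite subr_gt0 ltNge (le_trans z0 (ltW x0)) mulr0.
have mFz : measurable_fun setT (fun x => F (x, z)) by exact: measurableT_comp.
rewrite -(@ge0_integral_affine _ z 0)// -ge0_integralZl//; last 2 first.
  apply: (measurableT_comp mFz).
  by apply: measurable_funD => //; exact: measurable_funM.
  by rewrite lee_fin ltW.
rewrite /eBeta -ge0_integralZl//; last 2 first.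
- by apply/measurable_EFinP; exact: measurable_beta_integrand.
- by move=> u _; rewrite lee_fin beta_integrand_ge0.
apply: eq_integral => u _.
by rewrite /F /= addr0 -!EFinM gamma_integrand_convolution.
Qed.
End gamma_beta.

Section gamma_values.
Variable R : realType.
Implicit Types a b x y z u : R.
Local Notation mu := (@lebesgue_measure R).

Lemma continuous_powR_gt0 a x : 0 < x -> {for x, continuous (fun y => y `^ a)}.
Proof.
move=> x0; apply/differentiable_continuous/derivable1_diffP.
by apply: derivable_powR; rewrite in_itv/= andbT.
Qed.

Lemma integral_powR_cc1 a (e : R) : 0 < a -> 0 < e < 1 ->
  (\int[mu]_(u in `[e, 1%R]) (u `^ (a - 1))%:E = ((1 - e `^ a) / a)%:E)%E.
Proof.
move=> a0 /andP[e0 e1].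
have cF x : 0 < x -> {for x, continuous (fun u : R => a^-1 * u `^ a)}.
  by move=> x0; apply: cvgM; [exact: cvg_cst|exact: (continuous_powR_gt0 x0)].
rewrite (@continuous_FTC2 _ _ (fun u => a^-1 * u `^ a))//.
- by rewrite powR1 -EFinB; congr EFin; field; rewrite gt_eqF.
- apply: continuous_in_subspaceT => x; rewrite inE/= in_itv/= => /andP[ex _].
  exact: continuous_powR_gt0 (lt_le_trans e0 ex).
- split.
  + move=> x; rewrite in_itv/= => /andP[ex _].
    apply: derivableM; first exact: derivable_cst.
    by apply: derivable_powR; rewrite in_itv/= andbT (lt_trans e0).
  + by apply: cvg_at_right_filter; exact: cF.
  + by apply: cvg_at_left_filter; exact: cF.
- move=> x; rewrite in_itv/= => /andP[ex _].
  have x0 : 0 < x by exact: lt_trans ex.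
  have D := @is_deriveZ _ _ _ _ a^-1 _ _ _ (is_derive1_powR a x0).
  rewrite derive1E (@derive_val _ _ _ _ _ _ _ D) /GRing.scale /=.
  by rewrite mulKf// gt_eqF.
Qed.

(** For [a < 1] the integrand is unbounded at [0]: the integral is the limit of
the integrals from [1/(n+2)] to [1], which the fundamental theorem of calculus
computes.  The shift by 2 keeps these intervals non degenerate. *)
Lemma eBeta1 a : 0 < a -> eBeta a 1 = (a^-1)%:E.
Proof.
move=> a0; rewrite eBetaE.
have mf : measurable_fun [set: R] (fun u : R => (u `^ (a - 1))%:E).
  by apply/measurable_EFinP; exact: measurable_powR.
transitivity (\int[mu]_(u in `]0%R, 1%R[) (u `^ (a - 1))%:E)%E.
  by apply: eq_integral => u _; rewrite subrr powRr0 mulr1.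
rewrite integral_itv_bndo_bndc; last exact: measurable_funTS.
pose F (n : nat) : set R := `[harmonic n.+1, 1]%classic.
have <- : \bigcup_n F n = `]0%R, 1%R]%classic.
  apply/seteqP; split => [x [n _]|x]; rewrite /F /= !in_itv/=.
    by move=> /andP[nx ->]; rewrite andbT (lt_le_trans _ nx)// harmonic_gt0.
  move=> /andP[x0 x1].
  have [n _ nx] : \forall n \near \oo, `|0 - harmonic n| < x :> R.
    by apply: cvgr_dist_lt x0; exact: cvg_harmonic.
  exists n => //=; rewrite in_itv/= x1 andbT ltW//.
  by have := nx n.+1 (leqnSn _); rewrite sub0r normrN gtr0_norm ?harmonic_gt0.
have /cvg_lim <- // :
    (\int[mu]_(u in F n) (u `^ (a - 1))%:E)%E @[n --> \oo] -->
    (\int[mu]_(u in \bigcup_n F n) (u `^ (a - 1))%:E)%E.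
  apply: ge0_nondecreasing_set_cvg_integral.
  - apply/nondecreasing_seqP => n; rewrite subsetEset /F => x /=.
    rewrite !in_itv/= => /andP[nx ->]; rewrite andbT (le_trans _ nx)//.
    by rewrite lef_pV2 ?posrE ?ltr0n// ler_nat.
  - by move=> n; exact: measurable_itv.
  - by move=> n; exact: measurable_funTS.
  - by move=> n x _; rewrite lee_fin powR_ge0.
apply/cvg_lim => //.
rewrite (_ : (fun _ => _) =
    (fun n => ((1 - (@harmonic R n.+1) `^ a) / a)%:E)); last first.
  apply/funext => n; rewrite integral_powR_cc1// harmonic_gt0/=.
  by rewrite invf_lt1 ?ltr0n// ltr1n.
apply: cvg_EFin; first exact: nearW.
rewrite [X in _ --> X](_ : a^-1 = (1 - 0) / a); last by rewrite subr0 mul1r.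
rewrite (_ : _ \o _ = fun n => (1 - (@harmonic R n.+1) `^ a) / a)//.
apply: cvgM; last exact: cvg_cst.
apply: cvgB; first exact: cvg_cst.
have := powR_cvg0 a0 => /cvg_at_rightP; apply.
split=> [n|]; first exact: harmonic_gt0.
by have := @cvg_harmonic R; rewrite -cvg_shiftS.
Qed.

Lemma eGamma1 : eGamma (1 : R) = 1%E.
Proof.
rewrite -(integral_exponential_pdf (@ltr01 R)).
transitivity (\int[mu]_(y in `]0%R, +oo[) (expR (- y))%:E)%E.
  rewrite /eGamma [RHS]integral_mkcond; apply: eq_integral => y _.
  rewrite restrict_EFin /gamma_integrand /= !patchE; case: ifP => // _ /=.
  by rewrite subrr powRr0 mul1r.
rewrite integral_itv_obnd_cbnd; last first.
  by apply/measurable_EFinP; apply: measurableT_comp.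
rewrite [LHS]integral_mkcond; apply: eq_integral => y _.
rewrite restrict_EFin /exponential_pdf /= !patchE; case: ifP => // _.
by rewrite mul1r mulN1r.
Qed.

(** Euler's identity with [b = 1], in place of an integration by parts. *)
Lemma eGammaD1 a : 0 < a -> eGamma (a + 1) = (a%:E * eGamma a)%E.
Proof.
move=> a0; have := eGamma_eBeta a 1.
rewrite eGamma1 mule1 eBeta1// => ->.
by rewrite muleC -muleA -EFinM mulVf ?gt_eqF// mule1.
Qed.

Lemma eGammaS (n : nat) : eGamma (n.+1%:R : R) = (n`!%:R)%:E.
Proof.
elim: n => [|n IH]; first by rewrite eGamma1.
rewrite -[n.+2]addn1 natrD eGammaD1// IH -EFinM.
by rewrite factS natrM.
Qed.

(** Below [1] the integrand is at most [y^(a-1)], whose integral is [1/a]; beyond [1]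
it is at most the integrand at an integer above [a], where Gamma is a
factorial. *)
Lemma eGamma_lty a : 0 < a -> (eGamma a < +oo)%E.
Proof.
move=> a0; pose n := Num.bound a.
have an : a <= n%:R by rewrite ltW// archi_boundP// ltW.
apply: (@le_lt_trans _ _ (eBeta a 1 + eGamma n.+1%:R)%E); last first.
  by rewrite eBeta1// eGammaS -EFinD ltry.
rewrite /eBeta /eGamma -ge0_integralD//; first last.
- by apply/measurable_EFinP; exact: measurable_gamma_integrand.
- by move=> x _; rewrite lee_fin gamma_integrand_ge0.
- by apply/measurable_EFinP; exact: measurable_beta_integrand.
- by move=> x _; rewrite lee_fin beta_integrand_ge0.
apply: ge0_le_integral => //.
- by move=> x _; rewrite lee_fin gamma_integrand_ge0.
- by apply/measurable_EFinP; exact: measurable_gamma_integrand.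
- apply/measurable_EFinP; apply: measurable_funD.
    exact: measurable_beta_integrand.
  exact: measurable_gamma_integrand.
move=> y _; rewrite -EFinD lee_fin.
rewrite /gamma_integrand /beta_integrand !patchE !mem_setE !in_itv/= !andbT.
case: ltP => y0 /=; last by rewrite addr0.
rewrite subrr powRr0 mulr1.
case: ltP => y1.
  rewrite ler_wpDr ?mulr_ge0 ?powR_ge0 ?expR_ge0//.
  by rewrite ler_piMr ?powR_ge0// expR_le1 oppr_le0 ltW.
rewrite add0r ler_wpM2r ?expR_ge0// ler_powR//.
by rewrite lerB// (le_trans an)// ler_nat.
Qed.

Lemma eGammaE a : 0 < a -> eGamma a = (Gamma a)%:E.
Proof.
by move=> a0; rewrite GammaE fineK// ge0_fin_numE ?eGamma_ge0// eGamma_lty.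
Qed.

Lemma GammaD1 a : 0 < a -> Gamma (a + 1) = a * Gamma a.
Proof.
by move=> a0; apply: EFin_inj; rewrite EFinM -!eGammaE ?eGammaD1// addr_gt0.
Qed.

Lemma GammaS (n : nat) : Gamma (n.+1%:R : R) = n`!%:R.
Proof. by rewrite GammaE eGammaS. Qed.

(** Keep only the part of Euler's integral from [M] to [M + 1].  As [M] is free, this
shows that [Gamma (l * k + 1)] grows faster than any geometric sequence in [k]
when [0 < l]. *)
Lemma Gamma_ge a (M : R) : 0 <= a -> 0 < M ->
  M `^ a * expR (- (M + 1)) <= Gamma (a + 1).
Proof.
move=> a0 M0; rewrite -lee_fin -eGammaE ?ltr_wpDl//.
pose D : set R := `[M, M + 1]%classic.
have mD : measurable D by exact: measurable_itv.
apply: (@le_trans _ _ (\int[mu]_(y in D) (gamma_integrand (a + 1) y)%:E)%E);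
    last first.
  apply: ge0_subset_integral => //.
  - by apply/measurable_EFinP; exact: measurable_gamma_integrand.
  - by move=> x _; rewrite lee_fin gamma_integrand_ge0.
apply: (@le_trans _ _ (\int[mu]_(y in D) (M `^ a * expR (- (M + 1)))%:E)%E).
  rewrite integral_cst//=.
  rewrite /D lebesgue_measure_itv/= lte_fin ltrDl ltr01 -EFinD.
  by rewrite -EFinM addrAC subrr add0r mulr1 lexx.
apply: ge0_le_integral => //.
- by move=> x _; rewrite lee_fin mulr_ge0 ?powR_ge0 ?expR_ge0.
- apply/measurable_EFinP; apply: measurable_funTS.
  exact: measurable_gamma_integrand.
move=> y; rewrite /D /= in_itv/= => /andP[My yM]; rewrite lee_fin.
have y0 := lt_le_trans M0 My.
rewrite /gamma_integrand patchE mem_setE in_itv/= y0 addrK.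
rewrite ler_pM ?powR_ge0 ?expR_ge0 ?ge0_ler_powR ?nnegrE ?(ltW M0) ?(ltW y0)//.
by rewrite ler_expR lerN2.
Qed.

Lemma Gamma_gt0 a : 0 < a -> 0 < Gamma a.
Proof.
move=> a0; rewrite -(pmulr_rgt0 _ a0) -GammaD1//.
apply: lt_le_trans (Gamma_ge (ltW a0) ltr01).
by rewrite mulr_gt0 ?powR_gt0 ?expR_gt0.
Qed.

(** The beta integral is finite because the three Gamma values in Euler's identity
are finite and positive. *)
Lemma eBeta_Gamma a b : 0 < a -> 0 < b ->
  eBeta a b = (Gamma a * Gamma b / Gamma (a + b))%:E.
Proof.
move=> a0 b0; have := eGamma_eBeta a b.
rewrite !eGammaE ?addr_gt0// -EFinM => E.
have G0 : 0 < Gamma (a + b) by rewrite Gamma_gt0// addr_gt0.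
by rewrite mulrC EFinM E muleA -EFinM mulVf ?gt_eqF// mul1e.
Qed.

Lemma beta_integrable a b : 0 < a -> 0 < b ->
  mu.-integrable `]0%R, 1%R[
    (EFin \o (fun u => u `^ (a - 1) * (1 - u) `^ (b - 1))).
Proof.
move=> a0 b0; apply/integrableP; split.
  apply/measurable_EFinP; apply: measurable_funTS; apply: measurable_funM => //.
  by apply: (measurableT_comp (measurable_powR _)); exact: measurable_funB.
rewrite (_ : (\int[mu]_(u in _) _)%E = eBeta a b); last first.
  rewrite eBetaE; apply: eq_integral => u _ /=.
  by rewrite ger0_norm// mulr_ge0 ?powR_ge0.
by rewrite eBeta_Gamma// ltry.
Qed.

Lemma Rintegral_beta a b : 0 < a -> 0 < b ->
  \int[mu]_(u in `]0%R, 1%R[) (u `^ (a - 1) * (1 - u) `^ (b - 1)) =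
  Gamma a * Gamma b / Gamma (a + b).
Proof. by move=> a0 b0; rewrite /Rintegral -eBetaE eBeta_Gamma. Qed.

Lemma powR_affine_exponent (x c d : R) n : 0 < x ->
  x `^ (c + d * n%:R - 1) = x `^ (c - 1) * (x `^ d) ^+ n.
Proof.
move=> x0; rewrite addrAC (powRD (r := c - 1)); last first.
  by rewrite (gt_eqF x0) implybT.
by rewrite powRrM powR_mulrn ?powR_ge0.
Qed.
End gamma_values.

(** * Complex sequences and series *)

Section complex_analysis.
Variable R : realType.
Implicit Types z w : R[i].
Local Notation mu := (@lebesgue_measure R).

(** The norm of [R[i]] takes its values in [R[i]].  Its real-valued version can be
compared with real majorants and real series. *)
Definition cmod z : R := complex.Re `|z|.

Lemma normCE z : `|z| = (cmod z)%:C.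
Proof. by rewrite /cmod normc_def. Qed.

Lemma cmodE z : cmod z = Num.sqrt (complex.Re z ^+ 2 + complex.Im z ^+ 2).
Proof. by rewrite /cmod normc_def. Qed.

Lemma cmod_ge0 z : 0 <= cmod z.
Proof. by rewrite cmodE sqrtr_ge0. Qed.

Lemma cmodM z w : cmod (z * w) = cmod z * cmod w.
Proof. by apply: (@complexI R); rewrite rmorphM /= -!normCE normrM. Qed.

Lemma cmodD z w : cmod (z + w) <= cmod z + cmod w.
Proof. by rewrite -lecR rmorphD /= -!normCE ler_normD. Qed.

Lemma cmodX z n : cmod (z ^+ n) = cmod z ^+ n.
Proof. by apply: (@complexI R); rewrite rmorphXn /= -!normCE normrX. Qed.

Lemma cmodR (a : R) : cmod a%:C = `|a|.
Proof. by rewrite cmodE /= expr0n addr0 sqrtr_sqr. Qed.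

Lemma cmod_sum (u : nat -> R[i]) n :
  cmod (\sum_(0 <= i < n) u i) <= \sum_(0 <= i < n) cmod (u i).
Proof.
elim: n => [|n IH]; first by rewrite !big_geq// (cmodR 0) normr0.
by rewrite !big_nat_recr//= (le_trans (cmodD _ _))// lerD2r.
Qed.

Lemma abs_Re_le_cmod z : `|complex.Re z| <= cmod z.
Proof. by rewrite -lecR -normCE normc_ge_Re. Qed.

Lemma abs_Im_le_cmod z : `|complex.Im z| <= cmod z.
Proof. by rewrite cmodE -sqrtr_sqr ler_sqrt ?addr_ge0 ?sqr_ge0// lerDr sqr_ge0. Qed.

Lemma cmod_le_ReIm z : cmod z <= `|complex.Re z| + `|complex.Im z|.
Proof.
rewrite {1}[z]complexE (le_trans (cmodD _ _))//.
by rewrite cmodM !cmodR (cmodE 'i%C) /= expr0n add0r expr1n sqrtr1 mul1r.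
Qed.

Lemma ccvg_cmodP (u : nat -> R[i]) (l : R[i]) :
  ((u : nat -> R[i]^o) @ \oo --> (l : R[i]^o)) <->
  (forall e : R, 0 < e -> \forall n \near \oo, cmod (l - u n) < e).
Proof.
split=> [/cvgrPdist_lt ul e e0|ul]; last apply/cvgrPdist_lt => e.
  have e0' : 0 < e%:C :> R[i] by rewrite ltcR.
  by have := ul _ e0'; apply: filterS => n; rewrite normCE ltcR.
(* a positive complex number is a positive real *)
rewrite ltcE => /andP[/eqP /= eI e0].
have -> : e = (complex.Re e)%:C by apply/eqP; rewrite eq_complex /= eI !eqxx.
by have := ul _ e0; apply: filterS => n; rewrite normCE ltcR.
Qed.

Lemma ccvgP (u : nat -> R[i]) (l : R[i]) :
  ((u : nat -> R[i]^o) @ \oo --> (l : R[i]^o)) <->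
  ((fun n => complex.Re (u n)) @ \oo --> complex.Re l) /\
  ((fun n => complex.Im (u n)) @ \oo --> complex.Im l).
Proof.
split=> [/ccvg_cmodP ul|].
  split; apply/cvgrPdist_lt => e /ul; apply: filterS => n; apply: le_lt_trans.
    by rewrite (le_trans _ (abs_Re_le_cmod _))// raddfB.
  by rewrite (le_trans _ (abs_Im_le_cmod _))// raddfB.
move=> [/cvgrPdist_lt rl /cvgrPdist_lt il]; apply/ccvg_cmodP => e e0.
have e20 : 0 < e / 2 by rewrite divr_gt0.
near=> n; rewrite (le_lt_trans (cmod_le_ReIm _))// (splitr e) ltrD// raddfB /=.
  by near: n; exact: rl.
by near: n; exact: il.
Unshelve. all: end_near. Qed.

Lemma cmod_lim_le (u : nat -> R[i]) (l : R[i]) (L : R) :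
  ((u : nat -> R[i]^o) @ \oo --> (l : R[i]^o)) ->
  (forall n, cmod (u n) <= L) -> cmod l <= L.
Proof.
move=> /ccvg_cmodP ul uL; apply/ler_addgt0Pl => e /ul[n _ /(_ n (leqnn n)) /= ln].
by rewrite -[l](subrK (u n)) (le_trans (cmodD _ _))// lerD// ltW.
Qed.

Lemma csum_eq (u : nat -> R[i]) l :
  (series u : nat -> R[i]^o) @ \oo --> (l : R[i]^o) -> csummable u /\ csum u = l.
Proof.
move=> ul; split; first by apply/cvg_ex; exists l.
by rewrite /csum; apply: cvg_lim ul; exact: norm_hausdorff.
Qed.

Lemma csummable_cvg (u : nat -> R[i]) : csummable u ->
  (series u : nat -> R[i]^o) @ \oo --> (csum u : R[i]^o).
Proof. by []. Qed.

Lemma cmod_series_le (u : nat -> R[i]) (m : nat -> R) (n : nat) :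
  (forall i, cmod (u i) <= m i) -> cvgn (series m) ->
  cmod (series u n) <= limn (series m).
Proof.
move=> um cm; apply: le_trans (cmod_sum _ _) _.
apply: (@le_trans _ _ (series m n)); first exact: ler_sum.
apply: nondecreasing_cvgn_le => //.
apply/nondecreasing_seqP => k; rewrite /series /= big_nat_recr//= lerDl.
by rewrite (le_trans (cmod_ge0 (u k))).
Qed.

(** Weierstrass' test, applied to the real and imaginary parts, which are series of
real numbers. *)
Lemma csummable_dominated (u : nat -> R[i]) (m : nat -> R) :
  (forall i, cmod (u i) <= m i) -> cvgn (series m) -> csummable u.
Proof.
move=> um cm.
have cR (f : R[i] -> R) : (forall z, `|f z| <= cmod z) -> cvgn (series (f \o u)).
  move=> fz; apply: normed_cvg; apply: series_le_cvg cm => n /=.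
  - exact: normr_ge0.
  - exact: le_trans (cmod_ge0 (u n)) (um n).
  - exact: le_trans (fz _) (um n).
have cRe := cR _ abs_Re_le_cmod; have cIm := cR _ abs_Im_le_cmod.
apply/cvg_ex; exists (limn (series (@complex.Re R \o u)) +i*
                      limn (series (@complex.Im R \o u))).
apply/ccvgP; split => /=.
  rewrite (_ : (fun n => _) = series (@complex.Re R \o u))//.
  by apply/funext => n; rewrite /series /= raddf_sum.
rewrite (_ : (fun n => _) = series (@complex.Im R \o u))//.
by apply/funext => n; rewrite /series /= raddf_sum.
Qed.

(** * Integration of complex-valued functions *)

Definition cmeasurable (D : set R) (f : R -> R[i]) : Prop :=
  measurable_fun D (fun u => complex.Re (f u)) /\
  measurable_fun D (fun u => complex.Im (f u)).

Lemma ReM z w : complex.Re (z * w) =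
  complex.Re z * complex.Re w - complex.Im z * complex.Im w.
Proof. by case: z; case: w. Qed.

Lemma ImM z w : complex.Im (z * w) =
  complex.Re z * complex.Im w + complex.Im z * complex.Re w.
Proof. by case: z; case: w. Qed.

Variables (D : set R) (mD : measurable D).

Lemma cmeasurable_cst z : cmeasurable D (fun=> z).
Proof. by split. Qed.

Lemma cmeasurable_real (h : R -> R) : measurable_fun D h ->
  cmeasurable D (fun u => (h u)%:C).
Proof. by move=> mh; split. Qed.

Lemma cmeasurableM (f g : R -> R[i]) : cmeasurable D f -> cmeasurable D g ->
  cmeasurable D (fun u => f u * g u).
Proof.
move=> [fR fI] [gR gI]; split.
  under eq_fun do rewrite ReM.
  by apply: measurable_funB; apply: measurable_funM.
under eq_fun do rewrite ImM.
by apply: measurable_funD; apply: measurable_funM.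
Qed.

Lemma cmeasurable_sum (f : nat -> R -> R[i]) n :
  (forall i, cmeasurable D (f i)) -> cmeasurable D (fun u => \sum_(0 <= i < n) f i u).
Proof.
move=> mf; split.
  under eq_fun do rewrite raddf_sum; apply: measurable_sum => i; exact: (mf i).1.
under eq_fun do rewrite raddf_sum; apply: measurable_sum => i; exact: (mf i).2.
Qed.

Lemma cmeasurableX (f : R -> R[i]) n : cmeasurable D f ->
  cmeasurable D (fun u => f u ^+ n).
Proof.
move=> mf; elim: n => [|n IH].
  by under eq_fun do rewrite expr0; exact: cmeasurable_cst.
by under eq_fun do rewrite exprS; exact: cmeasurableM.
Qed.

Lemma cmeasurable_cvg (F : nat -> R -> R[i]) (f : R -> R[i]) :
  (forall n, cmeasurable D (F n)) ->
  (forall u, D u -> (F ^~ u : nat -> R[i]^o) @ \oo --> (f u : R[i]^o)) ->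
  cmeasurable D f.
Proof.
move=> mF Ff; split.
  apply: (measurable_fun_cvg (h := fun n u => complex.Re (F n u))).
    by move=> n; exact: (mF n).1.
  by move=> u /Ff/ccvgP[].
apply: (measurable_fun_cvg (h := fun n u => complex.Im (F n u))).
  by move=> n; exact: (mF n).2.
by move=> u /Ff/ccvgP[].
Qed.

Lemma cintegrable_le (f : R -> R[i]) (k : R -> R) : cmeasurable D f ->
  mu.-integrable D (EFin \o k) -> (forall u, D u -> cmod (f u) <= k u) ->
  cintegrable D f.
Proof.
move=> [mR mI] ik fk; split; apply: le_integrable ik => //.
- exact/measurable_EFinP.
- move=> u Du; rewrite /= lee_fin (le_trans (abs_Re_le_cmod _))//.
  by rewrite (le_trans (fk u Du))// ler_norm.
- exact/measurable_EFinP.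
- move=> u Du; rewrite /= lee_fin (le_trans (abs_Im_le_cmod _))//.
  by rewrite (le_trans (fk u Du))// ler_norm.
Qed.

Lemma cintegrable_measurable (f : R -> R[i]) :
  cintegrable D f -> cmeasurable D f.
Proof.
move=> [/measurable_int/measurable_EFinP fR /measurable_int/measurable_EFinP fI].
by split.
Qed.

Lemma Rintegral_dominated (F : nat -> R -> R) (f k : R -> R) :
  (forall n, measurable_fun D (F n)) -> measurable_fun D f ->
  (forall u, D u -> F ^~ u @ \oo --> f u) ->
  mu.-integrable D (EFin \o k) -> (forall n u, D u -> `|F n u| <= k u) ->
  \int[mu]_(u in D) F n u @[n --> \oo] --> \int[mu]_(u in D) f u.
Proof.
move=> mF mf Ff ik Fk.
have [|||//||if_ _ c] := @dominated_convergence _ _ R mu D mD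
  (fun n u => (F n u)%:E) (EFin \o f) (EFin \o k).
- by move=> n; apply/measurable_EFinP; exact: mF.
- exact/measurable_EFinP.
- apply: aeW => u Du; apply: cvg_EFin; first exact: nearW.
  exact: Ff.
- by apply: aeW => u n Du /=; rewrite lee_fin Fk.
rewrite /Rintegral; apply: fine_cvg.
by rewrite fineK//; exact: integrable_fin_num.
Qed.

Lemma cdominated_convergence (F : nat -> R -> R[i]) (f : R -> R[i]) (k : R -> R) :
  (forall n, cmeasurable D (F n)) ->
  mu.-integrable D (EFin \o k) ->
  (forall n u, D u -> cmod (F n u) <= k u) ->
  (forall u, D u -> (F ^~ u : nat -> R[i]^o) @ \oo --> (f u : R[i]^o)) ->
  ((fun n => cintegral D (F n)) : nat -> R[i]^o) @ \oo --> (cintegral D f : R[i]^o).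
Proof.
move=> mF ik Fk Ff.
have mf := cmeasurable_cvg mF Ff.
apply/ccvgP; split => /=.
  apply: (@Rintegral_dominated _ _ k) => //.
  - by move=> n; exact: (mF n).1.
  - exact: mf.1.
  - by move=> u /Ff/ccvgP[].
  - by move=> n u Du; rewrite (le_trans (abs_Re_le_cmod _))// Fk.
apply: (@Rintegral_dominated _ _ k) => //.
- by move=> n; exact: (mF n).2.
- exact: mf.2.
- by move=> u /Ff/ccvgP[].
- by move=> n u Du; rewrite (le_trans (abs_Im_le_cmod _))// Fk.
Qed.

Lemma eq_cintegral (f g : R -> R[i]) : (forall u, D u -> f u = g u) ->
  cintegral D f = cintegral D g.
Proof.
by move=> fg; rewrite /cintegral; congr (_ +i* _);
  apply: eq_Rintegral => u /[!inE] Du; rewrite fg.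
Qed.

Lemma cintegrableZ z (f : R -> R[i]) :
  cintegrable D f -> cintegrable D (fun u => z * f u).
Proof.
move=> [fR fI]; split.
  have -> : EFin \o (fun u => complex.Re (z * f u)) =
    (fun u => (complex.Re z)%:E * (complex.Re (f u))%:E -
              (complex.Im z)%:E * (complex.Im (f u))%:E)%E.
    by apply/funext => u /=; rewrite ReM.
  by apply: integrableB => //; exact: integrableZl.
have -> : EFin \o (fun u => complex.Im (z * f u)) =
  (fun u => (complex.Re z)%:E * (complex.Im (f u))%:E +
            (complex.Im z)%:E * (complex.Re (f u))%:E)%E.
  by apply/funext => u /=; rewrite ImM.
by apply: integrableD => //; exact: integrableZl.
Qed.

Lemma cintegralZ z (f : R -> R[i]) : cintegrable D f ->
  cintegral D (fun u => z * f u) = z * cintegral D f.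
Proof.
move=> [fR fI].
have iZ (a : R) (h : R -> R) : mu.-integrable D (EFin \o h) ->
    mu.-integrable D (EFin \o (fun u => a * h u)).
  move=> ih; rewrite (_ : EFin \o _ = (fun u => a%:E * (h u)%:E)%E)//.
  exact: integrableZl.
apply/eqP; rewrite eq_complex ReM ImM /cintegral /=; apply/andP; split; apply/eqP.
  under eq_Rintegral do rewrite ReM.
  by rewrite RintegralB ?RintegralZl//; exact: iZ.
under eq_Rintegral do rewrite ImM.
by rewrite RintegralD ?RintegralZl//; exact: iZ.
Qed.

Lemma cintegrableD (f g : R -> R[i]) : cintegrable D f -> cintegrable D g ->
  cintegrable D (fun u => f u + g u).
Proof.
move=> [fR fI] [gR gI]; split.
  have -> : EFin \o (fun u => complex.Re (f u + g u)) =
    (fun u => (complex.Re (f u))%:E + (complex.Re (g u))%:E)%E.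
    by apply/funext => u /=; rewrite raddfD.
  exact: integrableD.
have -> : EFin \o (fun u => complex.Im (f u + g u)) =
  (fun u => (complex.Im (f u))%:E + (complex.Im (g u))%:E)%E.
  by apply/funext => u /=; rewrite raddfD.
exact: integrableD.
Qed.

Lemma cintegralD (f g : R -> R[i]) : cintegrable D f -> cintegrable D g ->
  cintegral D (fun u => f u + g u) = cintegral D f + cintegral D g.
Proof.
move=> [fR fI] [gR gI].
rewrite /cintegral; under eq_Rintegral do rewrite raddfD.
under [X in _ +i* X]eq_Rintegral do rewrite raddfD.
by rewrite !RintegralD.
Qed.

Lemma cintegral_real (h : R -> R) :
  cintegral D (fun u => (h u)%:C) = (\int[mu]_(u in D) h u)%:C.
Proof. by rewrite /cintegral /= Rintegral_cst// mul0r. Qed.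

Lemma cintegrable_real (h : R -> R) : mu.-integrable D (EFin \o h) ->
  cintegrable D (fun u => (h u)%:C).
Proof. by move=> ih; split => //; exact: integrable0. Qed.

Lemma cintegral_sum (a : nat -> R[i]) (f : nat -> R -> R[i]) n :
  (forall i, cintegrable D (f i)) ->
  cintegrable D (fun u => \sum_(0 <= i < n) a i * f i u) /\
  cintegral D (fun u => \sum_(0 <= i < n) a i * f i u) =
  \sum_(0 <= i < n) a i * cintegral D (f i).
Proof.
move=> intf; elim: n => [|n [IH1 IH2]].
  rewrite big_geq//.
  under eq_fun do rewrite big_geq//.
  split; first by split; exact: integrable0.
  by rewrite /cintegral /= !Rintegral_cst// mul0r.
rewrite big_nat_recr//= -IH2 -cintegralZ//.
have aint := cintegrableZ (a n) (intf n).
under eq_fun do rewrite big_nat_recr//=.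
by split; [exact: cintegrableD|rewrite cintegralD].
Qed.

Section weighted.
Variable w : R -> R.
Hypotheses (iw : mu.-integrable D (EFin \o w)) (w0 : forall u, 0 <= w u).

Let iwM (L : R) : mu.-integrable D (EFin \o (fun u => w u * L)).
Proof.
rewrite (_ : EFin \o _ = (fun u => L%:E * (w u)%:E)%E); first exact: integrableZl.
by apply/funext => u /=; rewrite -EFinM mulrC.
Qed.

Let mw : cmeasurable D (fun u => (w u)%:C).
Proof. by apply: cintegrable_measurable; exact: cintegrable_real. Qed.

Let cmod_weight_le (z : R[i]) (u L : R) :
  cmod z <= L -> cmod ((w u)%:C * z) <= w u * L.
Proof. by move=> zL; rewrite cmodM cmodR (ger0_norm (w0 u)) ler_wpM2l. Qed.

Lemma cintegrable_weight_bounded (h : R -> R[i]) (L : R) :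
  cmeasurable D h -> (forall u, D u -> cmod (h u) <= L) ->
  cintegrable D (fun u => (w u)%:C * h u).
Proof.
move=> mh hL; apply: cintegrable_le (iwM L) _; first exact: cmeasurableM.
by move=> u Du; apply: cmod_weight_le; exact: hL.
Qed.

(** The partial sums times the weight are dominated by [w * L].  The bound is only
required from rank [N0] on: shifting the sequence of partial sums changes
neither its limit nor the conclusion. *)
Lemma cintegral_bounded_series (q : nat -> R -> R[i]) (G : R -> R[i])
    (L : R) (N0 : nat) :
  (forall n, cmeasurable D (q n)) ->
  (forall n, cintegrable D (fun u => (w u)%:C * q n u)) ->
  (forall N u, D u -> cmod (series (q ^~ u) (N + N0)%N) <= L) ->
  (forall u, D u -> (series (q ^~ u) : nat -> R[i]^o) @ \oo --> (G u : R[i]^o)) ->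
  [/\ cintegrable D (fun u => (w u)%:C * G u),
      csummable (fun n => cintegral D (fun u => (w u)%:C * q n u)) &
      csum (fun n => cintegral D (fun u => (w u)%:C * q n u)) =
      cintegral D (fun u => (w u)%:C * G u)].
Proof.
move=> mq iq qL qG.
have mS N : cmeasurable D (fun u => series (q ^~ u) N) by exact: cmeasurable_sum.
have qG0 u : D u ->
    ((fun N => series (q ^~ u) (N + N0)%N) : nat -> R[i]^o) @ \oo --> (G u : R[i]^o).
  move=> Du; rewrite (cvg_shiftn N0 (series (q ^~ u) : nat -> R[i]^o)).
  exact: qG.
pose F N u := (w u)%:C * series (q ^~ u) (N + N0)%N.
pose v n := cintegral D (fun u => (w u)%:C * q n u).
have FE N : cintegral D (F N) = series v (N + N0)%N.
  have [_ sumE] := cintegral_sum (fun=> 1) (N + N0)%N iq.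
  rewrite /series /=; under [RHS]eq_bigr => n _ do rewrite /v -[cintegral _ _]mul1r.
  rewrite -sumE; apply: eq_cintegral => u Du.
  by rewrite /F /series /= mulr_sumr; apply: eq_bigr => n _; rewrite mul1r.
have vG : (series v : nat -> R[i]^o) @ \oo -->
    (cintegral D (fun u => (w u)%:C * G u) : R[i]^o).
  rewrite -(cvg_shiftn N0).
  rewrite [X in X @ _](_ : _ = fun N => cintegral D (F N)); last first.
    by apply/funext => N; rewrite FE.
  apply: (cdominated_convergence (F := F) _ (iwM L)).
  - by move=> N; apply: cmeasurableM.
  - by move=> N u Du; apply: cmod_weight_le; exact: qL.
  - by move=> u Du; apply: cvgM; [exact: cvg_cst|exact: qG0].
have [sv vE] := csum_eq vG; split => //.
apply: (cintegrable_weight_bounded (L := L)); first exact: cmeasurable_cvg mS qG.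
by move=> u Du; apply: cmod_lim_le (qG0 u Du) _ => N; exact: qL.
Qed.
End weighted.
End complex_analysis.

(** * The Wright function as a beta integral of the Mittag-Leffler function *)

(** Choosing [M] with [x < M^l] in [Gamma_ge] compares the series with a geometric
one of ratio [x / M^l].  For [l = 0] this needs [x < 1]. *)
Lemma cvg_series_mittag_leffler (R : realType) (l x : R) :
  0 <= l -> 0 <= x -> (l = 0 -> x < 1) ->
  cvgn (series (fun k => x ^+ k / Gamma (l * k%:R + 1))).
Proof.
move=> l0 x0 lx.
have [M M0 xM] : exists2 M : R, 0 < M & x < M `^ l.
  have [l_eq0|l_neq0] := eqVneq l 0.
    by exists 1 => //; rewrite powR1 lx.
  exists ((x + 1) `^ l^-1); first by rewrite powR_gt0// ltr_wpDl.
  by rewrite -powRrM mulVf// powRr1 ?addr_ge0// ltrDl.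
have Ml0 : 0 < M `^ l by rewrite powR_gt0.
pose q := x / M `^ l.
have q0 : 0 <= q by rewrite divr_ge0// ltW.
have q1 : `|q| < 1 by rewrite ger0_norm// ltr_pdivrMr// mul1r.
have cG := @is_cvg_geometric_series R (expR (M + 1)) q q1.
have lk0 k : 0 <= l * k%:R by rewrite mulr_ge0.
apply: series_le_cvg cG => k /=.
- by rewrite divr_ge0 ?exprn_ge0// ltW// Gamma_gt0// ltr_wpDl.
- by rewrite mulr_ge0 ?expR_ge0// exprn_ge0.
have := Gamma_ge (lk0 k) M0; rewrite powRrM powR_mulrn ?powR_ge0// => Gk.
rewrite ler_pdivrMr ?Gamma_gt0 ?ltr_wpDl//.
apply: le_trans (ler_wpM2l _ Gk); last by rewrite mulr_ge0 ?expR_ge0// exprn_ge0.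
rewrite /q expr_div_n mulrA mulrAC -!mulrA [X in _ <= X](_ : _ =
  x ^+ k * ((M `^ l) ^- k * (M `^ l) ^+ k) *
  (expR (M + 1) * expR (- (M + 1)))); last by ring.
by rewrite -expRD subrr expR0 mulVf ?mulr1// expf_neq0// gt_eqF.
Qed.

Section mittag_leffler_kernel.
Variables (R : realType) (l : R) (p : R[i]).
Hypotheses (l0 : 0 <= l) (p_lt4 : l = 0 -> `|p| < 4).
Local Notation I01 := (`]0%R, 1%R[%classic : set R).

(** Majorant of the Mittag-Leffler terms at [p u (1 - u)]: [1/4] is the maximum of
[u (1 - u)]. *)
Definition mittag_leffler_majorant (k : nat) : R :=
  (cmod p / 4) ^+ k / Gamma (l * k%:R + 1).

Let kern (u : R) : nat -> R[i] := mittag_leffler_term l (p * (u * (1 - u))%:C).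

Let E (u : R) : R[i] := mittag_leffler l (p * (u * (1 - u))%:C).

Let cvg_majorant : cvgn (series mittag_leffler_majorant).
Proof.
apply: cvg_series_mittag_leffler => //; first by rewrite divr_ge0 ?cmod_ge0.
move=> /p_lt4.
rewrite normCE -[4]/(4%:R) -(rmorph_nat (real_complex R)) ltcR => p4.
by rewrite ltr_pdivrMr// mul1r.
Qed.

Let Gammal_gt0 k : 0 < Gamma (l * k%:R + 1).
Proof. by rewrite Gamma_gt0// ltr_wpDl// mulr_ge0. Qed.

Let kern_le (u : R) k : 0 <= u <= 1 -> cmod (kern u k) <= mittag_leffler_majorant k.
Proof.
move=> /andP[u0 u1]; rewrite /kern /mittag_leffler_term -fmorphV.
have Gi0 : 0 <= (Gamma (l * k%:R + 1))^-1 by rewrite invr_ge0 ltW.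
rewrite cmodM cmodX cmodM !cmodR ger0_norm ?mulr_ge0 ?subr_ge0//.
rewrite (ger0_norm Gi0) ler_wpM2r//.
rewrite lerXn2r ?nnegrE ?mulr_ge0 ?cmod_ge0 ?subr_ge0// ler_wpM2l ?cmod_ge0//.
by have := sqr_ge0 (u - 2^-1); lra.
Qed.

Lemma csummable_mittag_leffler (u : R) : 0 <= u <= 1 -> csummable (kern u).
Proof.
by move=> u01; apply: csummable_dominated cvg_majorant => k; exact: kern_le.
Qed.

Lemma cmod_mittag_leffler_series (u : R) N : 0 <= u <= 1 ->
  cmod (series (kern u) N) <= limn (series mittag_leffler_majorant).
Proof.
by move=> u01; apply: cmod_series_le cvg_majorant => k; exact: kern_le.
Qed.

Lemma cmod_mittag_leffler (u : R) : 0 <= u <= 1 ->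
  cmod (E u) <= limn (series mittag_leffler_majorant).
Proof.
move=> u01; apply: cmod_lim_le (csummable_cvg (csummable_mittag_leffler u01)) _.
by move=> N; exact: cmod_mittag_leffler_series.
Qed.

Let I01W u : I01 u -> 0 <= u <= 1.
Proof. by rewrite /= in_itv/= => /andP[? ?]; rewrite !ltW. Qed.

Let mkern k : cmeasurable I01 (kern ^~ k).
Proof.
rewrite /kern /mittag_leffler_term; apply: cmeasurableM => //.
apply: cmeasurableX => //; apply: cmeasurableM => //.
by apply: cmeasurable_real => //; apply: measurable_funM => //; exact: measurable_funB.
Qed.

Lemma cmeasurable_mittag_leffler : cmeasurable I01 E.
Proof.
apply: (cmeasurable_cvg (F := fun N u => series (kern u) N)) => //.
  by move=> N; exact: cmeasurable_sum.
by move=> u /I01W u01; apply: csummable_cvg; exact: csummable_mittag_leffler.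
Qed.

(** The factor [k!] produced by the pair [(1, 1)] cancels the factorial in the
definition of the Wright series. *)
Let wright_term_beta (a b : R) k : 0 < a -> 0 < b ->
  p ^+ k / (Gamma (l * k%:R + 1))%:C *
    (Gamma (a + 1 * k%:R) * Gamma (b + 1 * k%:R) /
     Gamma (a + 1 * k%:R + (b + 1 * k%:R)))%:C =
  wright_term [:: (a, 1); (b, 1); (1, 1)] [:: (a + b, 2); (1, l)] p k.
Proof.
move=> a0 b0; rewrite /wright_term 2!big_cons big_seq1 big_cons big_seq1 /=.
have factE : Gamma (1 + 1 * k%:R) = k`!%:R :> R.
  by rewrite mul1r -GammaS -natr1 addrC.
have abE : a + 1 * k%:R + (b + 1 * k%:R) = a + b + 2 * k%:R by ring.
have lE : Gamma (1 + l * k%:R) = Gamma (l * k%:R + 1) by rewrite addrC.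
rewrite factE abE lE.
have frac (F : fieldType) (x1 x2 x3 x4 x5 y : F) : x3 != 0 -> x4 != 0 -> x5 != 0 ->
    y / x4 * (x1 * x2 / x3) = x1 * (x2 * x5) / (x3 * x4) * (y / x5).
  by move=> ? ? ?; field; apply/and3P.
have nzC (x : R) : 0 < x -> x%:C != 0 by move=> x0; rewrite fmorph_eq0 gt_eqF.
rewrite !(rmorphM, fmorphV) /= (rmorph_nat (real_complex R)).
apply: frac; last by rewrite pnatr_eq0 -lt0n fact_gt0.
  by rewrite nzC// Gamma_gt0// ltr_wpDr ?mulr_ge0 ?addr_gt0.
exact: nzC.
Qed.

(** Integrated against the beta weight, the Mittag-Leffler term of index [k] is a
multiple of the beta integral whose two parameters are shifted by [k], namely
the Wright term of index [k].  The majorant bounds all partial sums, so that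
[cintegral_bounded_series] applies. *)
Lemma cintegral_beta_mittag_leffler (a b : R) : 0 < a -> 0 < b ->
  let w u := u `^ (a - 1) * (1 - u) `^ (b - 1) in
  let t := wright_term [:: (a, 1); (b, 1); (1, 1)] [:: (a + b, 2); (1, l)] p in
  [/\ cintegrable I01 (fun u => (w u)%:C * E u), csummable t &
      csum t = cintegral I01 (fun u => (w u)%:C * E u)].
Proof.
move=> a0 b0 w t.
have w0 u : 0 <= w u by rewrite mulr_ge0 ?powR_ge0.
have iw : (@lebesgue_measure R).-integrable I01 (EFin \o w) by exact: beta_integrable.
pose M := limn (series mittag_leffler_majorant).
have tE k : cintegral I01 (fun u => (w u)%:C * kern u k) = t k.
  pose co : R[i] := p ^+ k / (Gamma (l * k%:R + 1))%:C.
  pose h u : R := u `^ (a + 1 * k%:R - 1) * (1 - u) `^ (b + 1 * k%:R - 1).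
  have ak : 0 < a + 1 * k%:R by rewrite mul1r ltr_wpDr.
  have bk : 0 < b + 1 * k%:R by rewrite mul1r ltr_wpDr.
  transitivity (cintegral I01 (fun u => co * (h u)%:C)).
    apply: eq_cintegral => u /=; rewrite in_itv/= => /andP[u0 u1].
    have u1' : 0 < 1 - u by rewrite subr_gt0.
    rewrite /h !powR_affine_exponent// !powRr1 ?(ltW u0) ?(ltW u1')//.
    rewrite /kern /mittag_leffler_term /co /w !(rmorphM, rmorphXn) /=.
    by rewrite exprMn (exprMn _ (u%:C)); ring.
  rewrite cintegralZ//; last by apply: cintegrable_real => //; exact: beta_integrable.
  rewrite cintegral_real//.
  by have := Rintegral_beta ak bk; rewrite -/h => ->; exact: wright_term_beta.
have [||||iE st sE] := @cintegral_bounded_series _ I01 (measurable_itv _) w iw w0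
  (fun k u => kern u k) E M 0.
- exact: mkern.
- move=> k; apply: (@cintegrable_weight_bounded _ _ _ _ iw w0 _
    (mittag_leffler_majorant k)) => //.
  by move=> u /I01W u01; exact: kern_le.
- by move=> N u /I01W u01; rewrite addn0; exact: cmod_mittag_leffler_series.
- by move=> u /I01W u01; apply: csummable_cvg; exact: csummable_mittag_leffler.
by rewrite -(funext tE).
Qed.
End mittag_leffler_kernel.

(** * Term-by-term integration of the generating function *)

(** Among the entourages of [R[i]] those given by balls of real radius suffice. *)
Lemma uniform_cmod (R : realType) (D : set R) (F : nat -> R -> R[i])
    (f : R -> R[i]) :
  {uniform D, (F : nat -> R -> R[i]^o) @ \oo --> (f : R -> R[i]^o)} ->
  forall e : R, 0 < e ->
    \forall n \near \oo, forall u, D u -> cmod (f u - F n u) < e.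
Proof.
move=> Ff e e0.
have e0' : 0 < e%:C :> R[i] by rewrite ltcR.
pose E := [set xy : R[i]^o * R[i]^o | ball xy.1 e%:C xy.2].
have nE : nbhs (f : {uniform` D -> R[i]^o})
    [set h : {uniform` D -> R[i]^o} | forall u, D u -> E (f u, h u)].
  apply/uniform_nbhs; exists E; split => //.
  exact: entourage_ball (PosNum e0').
have [N _ FN] := Ff _ nE; exists N => // n Nn u Du.
have := FN n Nn u Du; rewrite /E /= -ball_normE /ball_ /=.
by rewrite normCE ltcR.
Qed.

(** A uniformly convergent series of bounded functions has uniformly bounded partial
sums from some rank on, and multiplying it by a bounded function [E] keeps this
property. *)
Lemma cintegral_uniform_series (R : realType) (D : set R) (w : R -> R)
    (E : R -> R[i]) (M : R) (q : nat -> R -> R[i]) (B : nat -> R) (G : R -> R[i]) :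
  measurable D ->
  (@lebesgue_measure R).-integrable D (EFin \o w) -> (forall u, 0 <= w u) ->
  cmeasurable D E -> (forall u, D u -> cmod (E u) <= M) ->
  (forall n, cmeasurable D (q n)) -> (forall n u, D u -> cmod (q n u) <= B n) ->
  (forall e : R, 0 < e -> \forall N \near \oo, forall u, D u ->
     cmod (G u - series (q ^~ u) N) < e) ->
  let v n := cintegral D (fun u => (w u)%:C * (q n u * E u)) in
  [/\ cintegrable D (fun u => (w u)%:C * (G u * E u)), csummable v &
      csum v = cintegral D (fun u => (w u)%:C * (G u * E u))].
Proof.
move=> mD iw w0 mE EM mq qB unif v.
have [N0 _ SN0] := unif 1 ltr01.
pose L := 1 + \sum_(0 <= n < N0) B n.
have GL u : D u -> cmod (G u) <= L.
  move=> Du; rewrite -[G u](subrK (series (q ^~ u) N0)) (le_trans (cmodD _ _))//.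
  rewrite lerD ?(ltW (SN0 _ (leqnn _) u Du))// (le_trans (cmod_sum _ _))//.
  by apply: ler_sum => i _; exact: qB.
have SL N u : D u -> cmod (series (q ^~ u) (N + N0)%N) <= 1 + L.
  move=> Du; rewrite -[series _ _](subrK (G u)) (le_trans (cmodD _ _))// lerD ?GL//.
  rewrite /cmod distrC -/(cmod _) ltW//.
  by apply: SN0 => //=; exact: leq_addl.
have SE u N : series (fun n => q n u * E u) N = series (q ^~ u) N * E u.
  by rewrite /series /= mulr_suml.
apply: (@cintegral_bounded_series _ _ _ w iw w0 (fun n u => q n u * E u)
  (fun u => G u * E u) ((1 + L) * M) N0) => //.
- by move=> n; exact: cmeasurableM.
- move=> n; apply: (@cintegrable_weight_bounded _ _ _ _ iw w0 _ (B n * M)) => //.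
    exact: cmeasurableM.
  by move=> u Du; rewrite cmodM ler_pM ?cmod_ge0 ?qB ?EM.
- by move=> N u Du; rewrite SE cmodM ler_pM ?cmod_ge0 ?SL ?EM.
- move=> u Du; rewrite (_ : series _ = fun N => series (q ^~ u) N * E u); last first.
    by apply/funext => N; exact: SE.
  apply: cvgM; last exact: cvg_cst.
  by apply/ccvg_cmodP => e /unif; apply: filterS => N; exact.
Qed.

Theorem theorem5 (R : realType) (X : Type)
    (c : nat -> R[i]) (g : nat -> X -> R[i]) (x : X) (t : R[i])
    (delta omega r s lambda : R) (p : R[i])
    (delta_ge0 : 0 <= delta) (omega_ge0 : 0 <= omega)
    (delta_omega_gt0 : 0 < delta + omega)
    (G_uniform :
      {uniform `]0, 1[,
        (fun (N : nat) (u : R) =>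
           series (genfun_term c g x
             (t * (u `^ delta * (1 - u) `^ omega)%:C)) N : R[i]^o) @ \oo -->
        (fun u : R => genfun c g x
             (t * (u `^ delta * (1 - u) `^ omega)%:C) : R[i]^o)})
    (r_gt0 : 0 < r) (r_lt_s : r < s) (lambda_ge0 : 0 <= lambda)
    (p_lt4 : lambda = 0 -> `|p| < 4) :
  let f := fun u : R =>
    (u `^ (r - 1) * (1 - u) `^ (s - r - 1))%:C *
    genfun c g x (t * (u `^ delta * (1 - u) `^ omega)%:C) *
    mittag_leffler lambda (p * (u * (1 - u))%:C) in
  let a := fun n : nat =>
    [:: (r + delta * n%:R, 1); (s - r + omega * n%:R, 1); (1, 1)] in
  let b := fun n : nat =>
    [:: (s + delta * n%:R + omega * n%:R, 2); (1, lambda)] in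
  let v := fun n : nat => c n * g n x * t ^+ n * wright (a n) (b n) p in
  [/\ forall u : R, u \in `]0, 1[ ->
        csummable (mittag_leffler_term lambda (p * (u * (1 - u))%:C)),
      cintegrable `]0, 1[ f,
      forall n : nat, csummable (wright_term (a n) (b n) p),
      csummable v
    & cintegral `]0, 1[ f = csum v].
Proof.
move=> f a b v.
pose D : set R := `]0%R, 1%R[%classic.
have mD : measurable D by exact: measurable_itv.
have D01 u : D u -> 0 < u < 1 by rewrite /D /= in_itv.
have D01W u : D u -> 0 <= u <= 1 by move=> /D01/andP[? ?]; rewrite !ltW.
pose w u : R := u `^ (r - 1) * (1 - u) `^ (s - r - 1).
pose phi u : R := u `^ delta * (1 - u) `^ omega.
pose E u := mittag_leffler lambda (p * (u * (1 - u))%:C).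
pose q n u := genfun_term c g x (t * (phi u)%:C) n.
have w_ge0 u : 0 <= w u by rewrite mulr_ge0 ?powR_ge0.
have phi_ge0 u : 0 <= phi u by rewrite mulr_ge0 ?powR_ge0.
have phi_le1 u : D u -> phi u <= 1.
  move=> /D01/andP[u0 u1].
  have powR_le1 (y e : R) : 0 < y <= 1 -> 0 <= e -> y `^ e <= 1.
    by move=> y01 e0; rewrite -(powRr0 y) ger_powR.
  by rewrite mulr_ile1 ?powR_ge0 ?powR_le1 ?u0 ?(ltW u1)// subr_gt0 u1 gerBl ltW.
have sr_gt0 : 0 < s - r by rewrite subr_gt0.
have an_gt0 n : 0 < r + delta * n%:R by rewrite ltr_wpDr ?mulr_ge0.
have bn_gt0 n : 0 < s - r + omega * n%:R by rewrite ltr_wpDr ?mulr_ge0.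
have wright_int n :=
  cintegral_beta_mittag_leffler lambda_ge0 p_lt4 (an_gt0 n) (bn_gt0 n).
have abE n : r + delta * n%:R + (s - r + omega * n%:R) =
    s + delta * n%:R + omega * n%:R by ring.
(* multiplying the weight by [phi u ^+ n] shifts its two exponents *)
have vE n : cintegral D (fun u => (w u)%:C * (q n u * E u)) = v n.
  rewrite /v /wright /a /b -abE; have [iE _ ->] := wright_int n.
  rewrite -cintegralZ//; apply: eq_cintegral => // u /D01/andP[u0 u1].
  have u1' : 0 < 1 - u by rewrite subr_gt0.
  rewrite /q /genfun_term /w !powR_affine_exponent// -/(E u) exprMn -rmorphXn /=.
  by rewrite /phi exprMn !rmorphM /=; ring.
have phi_m : cmeasurable D (fun u => (phi u)%:C).
  apply: cmeasurable_real => //; apply: measurable_funTS.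
  apply: measurable_funM => //; apply: (measurableT_comp (measurable_powR _)).
  exact: measurable_funB.
have [|||||||intf sumv sumE] := @cintegral_uniform_series _ D w E
    (limn (series (mittag_leffler_majorant lambda p))) q
    (fun n => cmod (c n * g n x * t ^+ n))
    (fun u => genfun c g x (t * (phi u)%:C)) mD.
- exact: (beta_integrable r_gt0 sr_gt0).
- exact: w_ge0.
- exact: cmeasurable_mittag_leffler.
- by move=> u /D01W Du; exact: cmod_mittag_leffler.
- move=> n; apply: cmeasurableM; first exact: cmeasurable_cst.
  by apply: cmeasurableX => //; apply: cmeasurableM => //; exact: cmeasurable_cst.
- move=> n u Du; rewrite /q /genfun_term exprMn mulrA cmodM.
  rewrite ler_piMr ?cmod_ge0// cmodX cmodR ger0_norm//.
  by rewrite exprn_ile1// phi_le1.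
- exact: (uniform_cmod G_uniform).
have fE : f = (fun u => (w u)%:C * (genfun c g x (t * (phi u)%:C) * E u)).
  by apply/funext => u; rewrite mulrA.
have {}vE : (fun n => cintegral D (fun u => (w u)%:C * (q n u * E u))) = v.
  exact/funext.
split.
- move=> u; rewrite in_itv/= => /andP[u0 u1].
  by apply: csummable_mittag_leffler => //; rewrite !ltW.
- by rewrite fE; exact: intf.
- by move=> n; have [_ + _] := wright_int n; rewrite abE.
- by rewrite -vE; exact: sumv.
- by rewrite fE -vE; exact/esym/sumE.
Qed.
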